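(* For any path-connected topological space $X$, there exists a concentration structure $\sim$ on the fundamental groupoid $\Pi(X)$ such that the concentration group satisfies $M_{(\Pi(X),\sim)}\cong\pi_1(X)$. In other words, $\Pi(X)$ is a horizontal categorification of $\pi_1(X)$.
   Context: Path-connected spaces are nonempty. The fundamental groupoid $\Pi(X)$ has the points of $X$ as objects; morphisms from $x$ to $y$ are homotopy classes relative to endpoints of paths from $x$ to $y$; composition is induced by concatenation. $f\circ g$ means first $g$, then $f$. A concentration structure on a small category $\mathcal{C}$ (with set of all morphisms $\mathrm{Mor}_{\mathcal{C}}$) is an equivalence relation $\sim$ on $\mathrm{Mor}_{\mathcal{C}}$ such that: (1) $\mathrm{id}_A\sim \mathrm{id}_B$ for all objects $A,B$; (2) if $f\sim f'$, $g\sim g'$ and both $f\circ g$, $f'\circ g'$ exist, then $f\circ g\sim f'\circ g'$; (3) for any morphisms $f,g$ there exist $f'\sim f$ and $g'\sim g$ such that $f'\circ g'$ exists; (4) for any morphisms $f\sim f'$, $g\sim g'$, $h\sim h'$, $m\sim f\circ g$, $n\sim g'\circ h'$, one has $f'\circ n\sim m\circ h$ whenever all the compositions involved are defined. The concentration monoid of $(\mathcal{C},\sim)$ is $M_{(\mathcal{C},\sim)}=\mathrm{Mor}_{\mathcal{C}}/\sim$ with multiplication $[f][g]=[f'\circ g']$, where $f'\sim f$, $g'\sim g$ are any morphisms such that $f'\circ g'$ exists; its identity is the class of any identity morphism. It is a group, called the concentration group, when $\mathcal{C}$ is a groupoid. A category $\mathcal{C}$ is a horizontal categorification of a monoid $M$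 if there exists a concentration structure $\sim$ on $\mathcal{C}$ with $M_{(\mathcal{C},\sim)}\cong M$. *)

(* Defs.v *)
From HB Require Import structures.
From mathcomp Require Import all_boot all_order all_algebra.
From mathcomp Require Import all_classical all_reals all_analysis homotopy.
From mathcomp Require Import lra.

Set Implicit Arguments.
Unset Strict Implicit.
Unset Printing Implicit Defensive.

Import Order.TTheory GRing.Theory Num.Theory.

(* [compm f g] is f o g: first g, then f. *)
Record category := Category {
  obj :> Type;
  hom : obj -> obj -> Type;
  idm : forall A, hom A A;
  compm : forall A B D, hom B D -> hom A B -> hom A D;
  compmA : forall A B D E (f : hom D E) (g : hom B D) (h : hom A B),
    compm f (compm g h) = compm (compm f g) h;
  compIm : forall A B (f : hom A B), compm (idm B) f = f;
  compmI : forall A B (f : hom A B), compm f (idm A) = f }.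

Arguments hom {c} A B.
Arguments idm {c} A.
Arguments compm {c A B D} f g.

Record groupoid := Groupoid {
  groupoid_category :> category;
  invm : forall A B : groupoid_category, hom A B -> hom B A;
  compVm : forall (A B : groupoid_category) (f : hom A B),
    compm (invm f) f = idm A;
  compmV : forall (A B : groupoid_category) (f : hom A B),
    compm f (invm f) = idm B }.

Arguments invm {g A B} f.

(* The morphisms of C with arbitrary source and target. Pairs of composable
   elements of [mor C] are exactly the pairs [Mor f], [Mor g] with
   [f : hom B D] and [g : hom A B]. *)
Record mor (C : category) := Mor {
  dom : C;
  cod : C;
  arrow : hom dom cod }.

Arguments Mor {C dom cod} arrow.

HB.instance Definition _ (C : category) := gen_eqMixin (mor C).
HB.instance Definition _ (C : category) := gen_choiceMixin (mor C).

Record concentration (C : category) := Concentration {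
  conc_rel :> mor C -> mor C -> Prop;
  conc_refl : forall f, conc_rel f f;
  conc_sym : forall f g, conc_rel f g -> conc_rel g f;
  conc_trans : forall g f h, conc_rel f g -> conc_rel g h -> conc_rel f h;
  conc_id : forall A B : C, conc_rel (Mor (idm A)) (Mor (idm B));
  conc_comp : forall (A B D A' B' D' : C)
      (f : hom B D) (g : hom A B) (f' : hom B' D') (g' : hom A' B'),
    conc_rel (Mor f) (Mor f') -> conc_rel (Mor g) (Mor g') ->
    conc_rel (Mor (compm f g)) (Mor (compm f' g'));
  conc_composable : forall f g : mor C,
    exists (A B D : C) (f' : hom B D) (g' : hom A B),
      conc_rel (Mor f') f /\ conc_rel (Mor g') g;
  conc_assoc : forall (A1 B1 D1 A2 B2 D2 A3 B3 D3 A4 B4 D4 : C)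
      (f : hom B1 D1) (g : hom A1 B1) (g' : hom B2 D2) (h' : hom A2 B2)
      (f' : hom B3 D3) (n : hom A3 B3) (m : hom B4 D4) (h : hom A4 B4),
    conc_rel (Mor f) (Mor f') -> conc_rel (Mor g) (Mor g') ->
    conc_rel (Mor h) (Mor h') ->
    conc_rel (Mor m) (Mor (compm f g)) ->
    conc_rel (Mor n) (Mor (compm g' h')) ->
    conc_rel (Mor (compm f' n)) (Mor (compm m h)) }.

Section ConcentrationMonoid.
Context (C : category) (s : concentration C).
Local Open Scope quotient_scope.

Let r (f g : mor C) : bool := `[< s f g >].

Let r_refl : reflexive r.
Proof. by move=> f; apply/asboolP; exact: conc_refl. Qed.

Let r_sym : symmetric r.
Proof.
by move=> f g; apply/idP/idP => /asboolP h; apply/asboolP; exact: conc_sym.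
Qed.

Let r_trans : transitive r.
Proof.
by move=> g f h /asboolP fg /asboolP gh; apply/asboolP; exact: conc_trans gh.
Qed.

Definition conc_equiv_rel : equiv_rel (mor C) := EquivRel r r_refl r_sym r_trans.

Definition conc_class : Type := {eq_quot conc_equiv_rel}.
HB.instance Definition _ := Choice.on conc_class.

Definition to_class (f : mor C) : conc_class := \pi_{eq_quot conc_equiv_rel} f.

Lemma to_classP (f g : mor C) : to_class f = to_class g <-> s f g.
Proof. by split=> [/eqmodP/asboolP|fg]//; apply/eqmodP/asboolP. Qed.

Lemma to_class_surj (a : conc_class) : exists f : mor C, a = to_class f.
Proof. by exists (repr (a : {eq_quot conc_equiv_rel})); rewrite /to_class reprK. Qed.

Lemma conc_mul_exists (a b : conc_class) :
  exists c : conc_class, exists (A B D : C) (f : hom B D) (g : hom A B),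
    [/\ a = to_class (Mor f), b = to_class (Mor g) &
        c = to_class (Mor (compm f g))].
Proof.
have [f ->] := to_class_surj a; have [g ->] := to_class_surj b.
have [A [B [D [f' [g' [ff' gg']]]]]] := conc_composable s f g.
exists (to_class (Mor (compm f' g'))), A, B, D, f', g'.
by split=> //; apply/to_classP; exact: conc_sym.
Qed.

Definition conc_mul (a b : conc_class) : conc_class :=
  sval (cid (conc_mul_exists a b)).

Lemma conc_mulE (A B D : C) (f : hom B D) (g : hom A B) :
  conc_mul (to_class (Mor f)) (to_class (Mor g)) = to_class (Mor (compm f g)).
Proof.
rewrite /conc_mul; case: cid => c /= [A' [B' [D' [f' [g' [ff' gg' ->]]]]]].
by apply/to_classP; apply: conc_comp; apply/to_classP.
Qed.

Lemma conc_mulA : associative conc_mul.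
Proof.
move=> a b c.
have [_ [A1 [B1 [D1 [f [g [Ea Eb _]]]]]]] := conc_mul_exists a b.
have [_ [A2 [B2 [D2 [g' [h' [Eb' Ec' _]]]]]]] := conc_mul_exists b c.
have [_ [A3 [B3 [D3 [f' [n [Ea' En _]]]]]]] :=
  conc_mul_exists a (conc_mul b c).
have [_ [A4 [B4 [D4 [m [h [Em Ec _]]]]]]] := conc_mul_exists (conc_mul a b) c.
rewrite En {1}Ea' conc_mulE Em {1}Ec conc_mulE; apply/to_classP.
apply: (@conc_assoc _ s _ _ _ _ _ _ _ _ _ _ _ _ f g g' h' f' n m h);
  apply/to_classP.
- by rewrite -Ea.
- by rewrite -Eb.
- by rewrite -Ec.
- by rewrite -Em Ea Eb conc_mulE.
- by rewrite -En Eb' Ec' conc_mulE.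
Qed.

Lemma conc_idE (A B : C) : to_class (Mor (idm A)) = to_class (Mor (idm B)).
Proof. by apply/to_classP; exact: conc_id. Qed.

(* The quotient of an empty category has no identity element, so the monoid
   takes an object, whose identity represents 1; by [conc_idE] the choice of
   the object is immaterial. *)
Definition conc_monoid (A : C) : Type := conc_class.

Variable A : C.

Lemma conc_mul1m : left_id (to_class (Mor (idm A))) conc_mul.
Proof.
move=> a; have [[D E f] ->] := to_class_surj a.
by rewrite (conc_idE A E) conc_mulE compIm.
Qed.

Lemma conc_mulm1 : right_id (to_class (Mor (idm A))) conc_mul.
Proof.
move=> a; have [[D E f] ->] := to_class_surj a.
by rewrite (conc_idE A D) conc_mulE compmI.
Qed.

HB.instance Definition _ := Choice.on (conc_monoid A).
HB.instance Definition _ := isMonoid.Build (conc_monoid A)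
  conc_mulA conc_mul1m conc_mulm1.

End ConcentrationMonoid.

Section ConcentrationGroup.
Context (G : groupoid) (s : concentration G).

Definition conc_group (A : G) : Type := conc_monoid s A.

Variable A : G.

Lemma conc_inv_exists (a : conc_class s) :
  exists b : conc_class s, exists (B D : G) (f : hom B D),
    a = to_class s (Mor f) /\ b = to_class s (Mor (invm f)).
Proof.
have [[B D f] ->] := to_class_surj a.
by exists (to_class s (Mor (invm f))), B, D, f.
Qed.

Definition conc_inv (a : conc_class s) : conc_class s :=
  sval (cid (conc_inv_exists a)).

Lemma conc_mulVm :
  left_inverse (to_class s (Mor (idm A))) conc_inv (@conc_mul _ s).
Proof.
move=> a; rewrite /conc_inv; case: cid => b /= [B [D [f [-> ->]]]].
by rewrite conc_mulE compVm; exact: conc_idE.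
Qed.

Lemma conc_mulmV :
  right_inverse (to_class s (Mor (idm A))) conc_inv (@conc_mul _ s).
Proof.
move=> a; rewrite /conc_inv; case: cid => b /= [B [D [f [-> ->]]]].
by rewrite conc_mulE compmV; exact: conc_idE.
Qed.

HB.instance Definition _ := Monoid.copy (conc_group A) (conc_monoid s A).
HB.instance Definition _ := hasInv.Build (conc_group A) conc_inv.
HB.instance Definition _ := Monoid_isGroup.Build (conc_group A)
  conc_mulVm conc_mulmV.

End ConcentrationGroup.

Definition monoid_isomorphic (M N : monoidType) : Prop :=
  exists phi : M -> N,
    [/\ bijective phi, phi 1%g = 1%g & {morph phi : a b / (a * b)%g}].

Definition horizontal_categorification (C : category) (M : monoidType) : Prop :=
  exists (s : concentration C) (A : C), monoid_isomorphic (conc_monoid s A) M.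

Local Open Scope classical_set_scope.
Local Open Scope ring_scope.
Import numFieldNormedType.Exports.

Definition unit_interval (R : realType) : Type := set_type (`[0, 1]%classic : set R).

Section UnitInterval.
Context {R : realType}.
Notation I := (unit_interval R).

HB.instance Definition _ := Topological.copy I (set_type (`[0, 1]%classic : set R)).

Definition ival (t : I) : R := set_val t.

Lemma ival_ge0 (t : I) : 0 <= ival t.
Proof. by have := set_mem (valP t); rewrite /= in_itv /= => /andP[]. Qed.

Lemma ival_le1 (t : I) : ival t <= 1.
Proof. by have := set_mem (valP t); rewrite /= in_itv /= => /andP[]. Qed.

Lemma ival_inj : injective ival.
Proof. exact: val_inj. Qed.

Lemma continuous_ival : continuous ival.
Proof. exact: (@initial_continuous _ _ (@set_val _ (`[0, 1]%classic : set R))). Qed.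

Lemma clamp_subproof (r : R) :
  Num.max 0 (Num.min r 1) \in (`[0, 1]%classic : set R).
Proof.
by rewrite inE /= in_itv /= le_max lexx ge_max ler01 ge_min lexx orbT.
Qed.

(* The retraction of the real line onto the unit interval, sending r to the
   nearest point of the interval. *)
Definition clamp (r : R) : I :=
  exist (fun t => t \in (`[0, 1]%classic : set R)) _ (clamp_subproof r).

Lemma ival_clamp (r : R) : ival (clamp r) = Num.max 0 (Num.min r 1).
Proof. by []. Qed.

Lemma clampK (r : R) : 0 <= r <= 1 -> ival (clamp r) = r.
Proof.
by rewrite ival_clamp => /andP[r0 r1]; rewrite min_l // max_r.
Qed.

Lemma ivalK : cancel ival clamp.
Proof.
by move=> t; apply: ival_inj; rewrite clampK // ival_ge0 ival_le1.
Qed.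

Lemma continuous_clamp : continuous clamp.
Proof.
apply: continuous_comp_initial.
have -> : set_val \o clamp = cst 0 \max (id \min cst 1) by [].
apply: max_fun_continuous; first by move=> ?; exact: cvg_cst.
by apply: min_fun_continuous => ?; [exact: cvg_id|exact: cvg_cst].
Qed.

Lemma izero_neq_one : clamp 0 != clamp 1.
Proof.
apply/eqP => /(congr1 ival); rewrite !clampK ?lexx ?ler01 // => /esym/eqP.
by rewrite oner_eq0.
Qed.

HB.instance Definition _ := isBiPointed.Build I izero_neq_one.

Lemma ival_zero : ival zero = 0.
Proof. by rewrite clampK ?lexx ?ler01. Qed.

Lemma ival_one : ival one = 1.
Proof. by rewrite clampK ?lexx ?ler01. Qed.

Lemma clamp_le0 (r : R) : r <= 0 -> clamp r = zero.
Proof.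
move=> r0; apply: ival_inj; rewrite ival_zero ival_clamp.
by rewrite min_l ?max_l // (le_trans r0).
Qed.

Lemma clamp_ge1 (r : R) : 1 <= r -> clamp r = one.
Proof.
by move=> r1; apply: ival_inj; rewrite ival_one ival_clamp min_r ?max_r.
Qed.

End UnitInterval.

Section Paths.
Context {R : realType} {X : topologicalType}.
Notation I := (unit_interval R).

Definition path_connected : Prop :=
  inhabited X /\ forall x y : X, inhabited {path I from x to y in X}.

Definition path_homotopic (x y : X) (p q : {path I from x to y in X}) : Prop :=
  exists H : I * I -> X,
    [/\ continuous H,
        forall s, H (s, zero) = p s,
        forall s, H (s, one) = q s,
        forall t, H (zero, t) = x &
        forall t, H (one, t) = y].

Lemma continuous_paste (T U : topologicalType) (k : T -> R) (c : R)
    (f g : T -> U) :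
  continuous k -> continuous f -> continuous g ->
  (forall t, k t = c -> f t = g t) ->
  continuous (fun t => if k t <= c then f t else g t).
Proof.
move=> ck cf cg fg; apply/continuous_subspace_setT.
have -> : [set: T] = k @^-1` [set r | r <= c] `|` k @^-1` [set r | c <= r].
  by apply/seteqP; split=> // t _; apply/orP; exact: le_total.
apply: withinU_continuous.
- by apply: preimage_closed => [t _|]; [exact: ck|exact: closed_le].
- by apply: preimage_closed => [t _|]; [exact: ck|exact: closed_ge].
- apply: (@subspace_eq_continuous _ _ _ f); last exact: continuous_subspaceT.
  by move=> t; rewrite inE /from_subspace /= => ->.
- apply: (@subspace_eq_continuous _ _ _ g); last exact: continuous_subspaceT.
  move=> t; rewrite inE /from_subspace /= => kc.
  by case: (leP (k t) c) => // kc'; rewrite fg //; apply/eqP; rewrite eq_le kc'.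
Qed.

Lemma comp_cts (T U V : topologicalType) (f : T -> U) (g : U -> V) :
  continuous f -> continuous g -> continuous (fun t => g (f t)).
Proof. by move=> cf cg t; apply: continuous_comp; [exact: cf|exact: cg]. Qed.

Lemma pair_cts (T U V : topologicalType) (f : T -> U) (g : T -> V) :
  continuous f -> continuous g -> continuous (fun t => (f t, g t)).
Proof. by move=> cf cg t; apply: cvg_pair; [exact: cf|exact: cg]. Qed.

Lemma fst_cts (T U : topologicalType) : continuous (@fst T U).
Proof. by move=> t; exact: cvg_fst. Qed.

Lemma snd_cts (T U : topologicalType) : continuous (@snd T U).
Proof. by move=> t; exact: cvg_snd. Qed.

Lemma cst_cts (T U : topologicalType) (u : U) : continuous ((fun=> u) : T -> U).
Proof. by move=> t; exact: cvg_cst. Qed.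

Lemma mulr_cts (T : topologicalType) (f g : T -> R) :
  continuous f -> continuous g -> continuous (fun t => f t * g t).
Proof. by move=> cf cg t; apply: cvgM; [exact: cf|exact: cg]. Qed.

Lemma addr_cts (T : topologicalType) (f g : T -> R) :
  continuous f -> continuous g -> continuous (fun t => f t + g t).
Proof. by move=> cf cg t; apply: cvgD; [exact: cf|exact: cg]. Qed.

Lemma subr_cts (T : topologicalType) (f g : T -> R) :
  continuous f -> continuous g -> continuous (fun t => f t - g t).
Proof. by move=> cf cg t; apply: cvgB; [exact: cf|exact: cg]. Qed.

Section Operations.
Variables (x y z : X).

Section Cat.
Variables (p : {path I from x to y in X}) (q : {path I from y to z in X}).

Definition path_cat (t : I) : X :=
  if ival t <= 2^-1 then p (clamp (2 * ival t))
  else q (clamp (2 * ival t - 1)).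

Let path_cat_cts : continuous path_cat.
Proof.
apply: continuous_paste; first exact: continuous_ival.
- apply: comp_cts; last exact: cts_fun.
  apply: comp_cts; last exact: continuous_clamp.
  by apply: mulr_cts; [exact: cst_cts|exact: continuous_ival].
- apply: comp_cts; last exact: cts_fun.
  apply: comp_cts; last exact: continuous_clamp.
  apply: subr_cts; last exact: cst_cts.
  by apply: mulr_cts; [exact: cst_cts|exact: continuous_ival].
- move=> t ->; rewrite divff ?pnatr_eq0 // subrr clamp_ge1 // clamp_le0 //.
  by rewrite path_one path_zero.
Qed.

Let path_cat_zero : path_cat zero = x.
Proof.
by rewrite /path_cat ival_zero invr_ge0 ler0n mulr0 clamp_le0 // path_zero.
Qed.

Let path_cat_one : path_cat one = z.
Proof.
rewrite /path_cat ival_one ifF; last by apply/negbTE; rewrite -ltNge; lra.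
by rewrite clamp_ge1 ?path_one //; lra.
Qed.

HB.instance Definition _ := isContinuous.Build I X path_cat path_cat_cts.
HB.instance Definition _ :=
  isPath.Build I X x z path_cat path_cat_zero path_cat_one.

End Cat.

Section Rev.
Variable p : {path I from x to y in X}.

Definition path_rev (t : I) : X := p (clamp (1 - ival t)).

Let path_rev_cts : continuous path_rev.
Proof.
apply: comp_cts; last exact: cts_fun.
apply: comp_cts; last exact: continuous_clamp.
by apply: subr_cts; [exact: cst_cts|exact: continuous_ival].
Qed.

Let path_rev_zero : path_rev zero = y.
Proof. by rewrite /path_rev ival_zero subr0 clamp_ge1 ?path_one. Qed.

Let path_rev_one : path_rev one = x.
Proof. by rewrite /path_rev ival_one subrr clamp_le0 ?path_zero. Qed.

HB.instance Definition _ := isContinuous.Build I X path_rev path_rev_cts.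
HB.instance Definition _ :=
  isPath.Build I X y x path_rev path_rev_zero path_rev_one.

End Rev.
End Operations.

Definition path_cst (x : X) : {path I from x to x in X} := cst x.

Section Equivalence.
Variables x y : X.
Implicit Types p q r : {path I from x to y in X}.

Lemma path_homotopic_refl p : path_homotopic p p.
Proof.
exists (fun u => p u.1); split=> // [|t|t].
- by apply: comp_cts; [exact: fst_cts|exact: cts_fun].
- by rewrite path_zero.
- by rewrite path_one.
Qed.

Lemma path_homotopic_sym p q : path_homotopic p q -> path_homotopic q p.
Proof.
move=> [H [cH H0 H1 Hx Hy]].
exists (fun u => H (u.1, clamp (1 - ival u.2))); split=> // [|s|s].
- apply: comp_cts; last exact: cH.
  apply: pair_cts; first exact: fst_cts.
  apply: comp_cts; last exact: continuous_clamp.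
  apply: subr_cts; first exact: cst_cts.
  exact: (comp_cts (@snd_cts I I) continuous_ival).
- by rewrite ival_zero subr0 clamp_ge1.
- by rewrite ival_one subrr clamp_le0.
Qed.

Lemma path_homotopic_trans q p r :
  path_homotopic p q -> path_homotopic q r -> path_homotopic p r.
Proof.
move=> [H [cH H0 H1 Hx Hy]] [K [cK K0 K1 Kx Ky]].
have cival2 : continuous (fun u : I * I => ival u.2).
  exact: (comp_cts (@snd_cts I I) continuous_ival).
exists (fun u => if ival u.2 <= 2^-1 then H (u.1, clamp (2 * ival u.2))
                 else K (u.1, clamp (2 * ival u.2 - 1))); split.
- apply: continuous_paste => // [||[s t] /= ->].
  + apply: comp_cts; last exact: cH.
    apply: pair_cts; first exact: fst_cts.
    apply: comp_cts; last exact: continuous_clamp.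
    by apply: mulr_cts; [exact: cst_cts|exact: cival2].
  + apply: comp_cts; last exact: cK.
    apply: pair_cts; first exact: fst_cts.
    apply: comp_cts; last exact: continuous_clamp.
    apply: subr_cts; last exact: cst_cts.
    by apply: mulr_cts; [exact: cst_cts|exact: cival2].
  + by rewrite divff ?pnatr_eq0 // subrr clamp_ge1 // clamp_le0 // H1 K0.
- by move=> s /=; rewrite ival_zero invr_ge0 ler0n mulr0 clamp_le0.
- move=> s /=; rewrite ival_one ifF; last by apply/negbTE; rewrite -ltNge; lra.
  by rewrite clamp_ge1 //; lra.
- by move=> t /=; case: ifP.
- by move=> t /=; case: ifP.
Qed.

Let r (p q : {path I from x to y in X}) : bool := `[< path_homotopic p q >].

Let r_refl : reflexive r.
Proof. by move=> p; apply/asboolP; exact: path_homotopic_refl. Qed.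

Let r_sym : symmetric r.
Proof.
by move=> p q; apply/idP/idP => /asboolP h; apply/asboolP;
  exact: path_homotopic_sym.
Qed.

Let r_trans : transitive r.
Proof.
move=> q p s /asboolP pq /asboolP qs; apply/asboolP.
exact: path_homotopic_trans qs.
Qed.

Definition path_homotopic_equiv_rel : equiv_rel {path I from x to y in X} :=
  EquivRel r r_refl r_sym r_trans.

End Equivalence.

Lemma path_cat_clamp (x y z : X) (p : {path I from x to y in X})
    (q : {path I from y to z in X}) (r : R) :
  path_cat p q (clamp r) =
  if r <= 2^-1 then p (clamp (2 * r)) else q (clamp (2 * r - 1)).
Proof.
rewrite /path_cat; have [r0|r0] := leP r 0.
  by rewrite (clamp_le0 r0) ival_zero !ifT ?clamp_le0 //; lra.
have [r1|r1] := leP 1 r.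
  rewrite (clamp_ge1 r1) ival_one !ifF; [|apply/negbTE; rewrite -ltNge; lra..].
  by rewrite !clamp_ge1 //; lra.
by rewrite clampK // !ltW.
Qed.

Lemma path_rev_clamp (x y : X) (p : {path I from x to y in X}) (r : R) :
  path_rev p (clamp r) = p (clamp (1 - r)).
Proof.
rewrite /path_rev; have [r0|r0] := leP r 0.
  by rewrite (clamp_le0 r0) ival_zero !clamp_ge1 //; lra.
have [r1|r1] := leP 1 r.
  by rewrite (clamp_ge1 r1) ival_one !clamp_le0 //; lra.
by rewrite clampK // !ltW.
Qed.

Lemma path_homotopic_reparam (x y a b : X) (p : {path I from x to y in X})
    (f g : {path I from a to b in X}) (phi psi : I -> R) :
  continuous phi -> continuous psi ->
  phi zero = psi zero -> phi one = psi one ->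
  (forall s, f s = p (clamp (phi s))) ->
  (forall s, g s = p (clamp (psi s))) ->
  path_homotopic f g.
Proof.
move=> cphi cpsi pp0 pp1 fE gE.
exists (fun u => p (clamp (phi u.1 + ival u.2 * (psi u.1 - phi u.1)))).
split=> [|s|s|t|t] /=.
- apply: comp_cts; last exact: cts_fun.
  apply: comp_cts; last exact: continuous_clamp.
  have c1 := comp_cts (@fst_cts I I) cphi.
  have c2 := comp_cts (@fst_cts I I) cpsi.
  have c3 := comp_cts (@snd_cts I I) continuous_ival.
  apply: addr_cts; first exact: c1.
  by apply: mulr_cts; [exact: c3|apply: subr_cts; [exact: c2|exact: c1]].
- by rewrite ival_zero mul0r addr0 fE.
- by rewrite ival_one mul1r addrC subrK gE.
- by rewrite pp0 subrr mulr0 addr0 -gE path_zero.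
- by rewrite pp1 subrr mulr0 addr0 -gE path_one.
Qed.

Section Laws.
Variables x y z w : X.

Lemma path_revK (p : {path I from x to y in X}) :
  path_rev (path_rev p) = p :> {path I from x to y in X}.
Proof.
apply/path_eqP => t /=.
change (path_rev p (clamp (1 - ival t)) = p t).
by rewrite path_rev_clamp subKr ivalK.
Qed.

Lemma path_cat_homotopic (p p' : {path I from x to y in X})
    (q q' : {path I from y to z in X}) :
  path_homotopic p p' -> path_homotopic q q' ->
  path_homotopic (path_cat p q) (path_cat p' q').
Proof.
move=> [H [cH H0 H1 Hx Hy]] [K [cK K0 K1 Kx Ky]].
have cival1 : continuous (fun u : I * I => ival u.1).
  exact: (comp_cts (@fst_cts I I) continuous_ival).
exists (fun u => if ival u.1 <= 2^-1 then H (clamp (2 * ival u.1), u.2)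
                 else K (clamp (2 * ival u.1 - 1), u.2)); split.
- apply: continuous_paste => // [||[s t] /= ->].
  + apply: comp_cts; last exact: cH.
    apply: pair_cts; last exact: snd_cts.
    apply: comp_cts; last exact: continuous_clamp.
    by apply: mulr_cts; [exact: cst_cts|exact: cival1].
  + apply: comp_cts; last exact: cK.
    apply: pair_cts; last exact: snd_cts.
    apply: comp_cts; last exact: continuous_clamp.
    apply: subr_cts; last exact: cst_cts.
    by apply: mulr_cts; [exact: cst_cts|exact: cival1].
  + by rewrite divff ?pnatr_eq0 // subrr clamp_ge1 // clamp_le0 // Hy Kx.
- by move=> s /=; rewrite H0 K0.
- by move=> s /=; rewrite H1 K1.
- by move=> t /=; rewrite ival_zero invr_ge0 ler0n mulr0 clamp_le0.
- move=> t /=; rewrite ival_one ifF; last by apply/negbTE; rewrite -ltNge; lra.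
  by rewrite clamp_ge1 //; lra.
Qed.

Lemma path_cat1p (p : {path I from x to y in X}) :
  path_homotopic (path_cat (path_cst x) p) p.
Proof.
apply: (@path_homotopic_reparam _ _ _ _ p _ _
          (fun s => Num.max 0 (2 * ival s - 1)) ival).
- apply: max_fun_continuous; first exact: cst_cts.
  apply: subr_cts; last exact: cst_cts.
  by apply: mulr_cts; [exact: cst_cts|exact: continuous_ival].
- exact: continuous_ival.
- by rewrite ival_zero max_l //; lra.
- by rewrite ival_one max_r //; lra.
- move=> s /=; rewrite /path_cat; case: leP => s2.
    by rewrite max_l ?(clamp_le0 (lexx 0)) ?path_zero //; lra.
  by rewrite max_r //; lra.
- by move=> s; rewrite ivalK.
Qed.

Lemma path_catp1 (p : {path I from x to y in X}) :
  path_homotopic (path_cat p (path_cst y)) p.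
Proof.
apply: (@path_homotopic_reparam _ _ _ _ p _ _
          (fun s => Num.min (2 * ival s) 1) ival).
- apply: min_fun_continuous; last exact: cst_cts.
  by apply: mulr_cts; [exact: cst_cts|exact: continuous_ival].
- exact: continuous_ival.
- by rewrite ival_zero min_l //; lra.
- by rewrite ival_one min_r //; lra.
- move=> s /=; rewrite /path_cat; case: leP => s2.
    by rewrite min_l //; lra.
  by rewrite min_r ?(clamp_ge1 (lexx 1)) ?path_one //; lra.
- by move=> s; rewrite ivalK.
Qed.

Lemma path_catpV (p : {path I from x to y in X}) :
  path_homotopic (path_cat p (path_rev p)) (path_cst x).
Proof.
have c2 : continuous (fun s : I => 2 * ival s).
  by apply: mulr_cts; [exact: cst_cts|exact: continuous_ival].
apply: (@path_homotopic_reparam _ _ _ _ p _ _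
          (fun s => Num.min (2 * ival s) (2 - 2 * ival s)) (fun=> 0)).
- apply: min_fun_continuous; first exact: c2.
  by apply: subr_cts; [exact: cst_cts|exact: c2].
- exact: cst_cts.
- by rewrite ival_zero min_l //; lra.
- by rewrite ival_one min_r //; lra.
- move=> s /=; rewrite /path_cat /= path_rev_clamp; case: leP => s2.
    by rewrite min_l //; lra.
  by rewrite min_r; [congr (p (clamp _)); lra|lra].
- by move=> s; rewrite clamp_le0 // path_zero.
Qed.

Lemma path_catA (p : {path I from x to y in X})
    (q : {path I from y to z in X}) (r : {path I from z to w in X}) :
  path_homotopic (path_cat (path_cat p q) r) (path_cat p (path_cat q r)).
Proof.
have cA : continuous (fun s : I => 2 * ival s).
  by apply: mulr_cts; [exact: cst_cts|exact: continuous_ival].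
have cB : continuous (fun s : I => ival s + 4^-1).
  by apply: addr_cts; [exact: continuous_ival|exact: cst_cts].
have cD : continuous (fun s : I => (ival s + 1) * 2^-1).
  apply: mulr_cts; last exact: cst_cts.
  by apply: addr_cts; [exact: continuous_ival|exact: cst_cts].
pose phi (s : I) :=
  Num.min (2 * ival s) (Num.min (ival s + 4^-1) ((ival s + 1) * 2^-1)).
apply: (@path_homotopic_reparam _ _ _ _ (path_cat p (path_cat q r)) _ _ phi ival).
- apply: min_fun_continuous; first exact: cA.
  by apply: min_fun_continuous; [exact: cB|exact: cD].
- exact: continuous_ival.
- rewrite /phi ival_zero min_l; first by lra.
  by rewrite le_min; apply/andP; split; lra.
- rewrite /phi ival_one [X in Num.min _ X]min_r; last by lra.
  by rewrite min_r; lra.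
- move=> s /=; rewrite path_cat_clamp {1}/path_cat /= !path_cat_clamp.
  rewrite /phi; have [s2|s2] := leP (ival s) 2^-1.
    rewrite [X in Num.min _ X]min_l; last by lra.
    have [s4|s4] := leP (2 * ival s) 2^-1.
      by rewrite min_l ?s4 //; lra.
    rewrite min_r; last by lra.
    rewrite ifF; last by apply/negbTE; rewrite -ltNge; lra.
    by rewrite ifT; [congr (q (clamp _)); lra|lra].
  rewrite [X in Num.min _ X]min_r; last by lra.
  rewrite min_r; last by lra.
  rewrite ifF; last by apply/negbTE; rewrite -ltNge; lra.
  rewrite ifF; last by apply/negbTE; rewrite -ltNge; lra.
  by congr (r (clamp _)); lra.
- by move=> s; rewrite ivalK.
Qed.

End Laws.

Local Open Scope quotient_scope.

Definition homotopy_class (x y : X) : Type :=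
  {eq_quot path_homotopic_equiv_rel x y}.

HB.instance Definition _ (x y : X) := Choice.on (homotopy_class x y).

Definition to_homotopy_class (x y : X) (p : {path I from x to y in X}) :
    homotopy_class x y :=
  \pi_{eq_quot path_homotopic_equiv_rel x y} p.

Lemma to_homotopy_classP (x y : X) (p q : {path I from x to y in X}) :
  to_homotopy_class p = to_homotopy_class q <-> path_homotopic p q.
Proof. by split=> [/eqmodP/asboolP|pq]//; apply/eqmodP/asboolP. Qed.

Definition class_repr (x y : X) (a : homotopy_class x y) :
    {path I from x to y in X} :=
  repr (a : {eq_quot path_homotopic_equiv_rel x y}).

Lemma class_reprK (x y : X) (a : homotopy_class x y) :
  to_homotopy_class (class_repr a) = a.
Proof. by rewrite /to_homotopy_class /class_repr reprK. Qed.

Definition class_cst (x : X) : homotopy_class x x :=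
  to_homotopy_class (path_cst x).

Definition class_cat (x y z : X) (a : homotopy_class x y)
    (b : homotopy_class y z) : homotopy_class x z :=
  to_homotopy_class (path_cat (class_repr a) (class_repr b)).

Definition class_rev (x y : X) (a : homotopy_class x y) : homotopy_class y x :=
  to_homotopy_class (path_rev (class_repr a)).

Lemma class_catE (x y z : X) (p : {path I from x to y in X})
    (q : {path I from y to z in X}) :
  class_cat (to_homotopy_class p) (to_homotopy_class q) =
  to_homotopy_class (path_cat p q).
Proof.
apply/to_homotopy_classP; apply: path_cat_homotopic;
  by apply/to_homotopy_classP; rewrite class_reprK.
Qed.

Lemma class_cat1a (x y : X) (a : homotopy_class x y) :
  class_cat (class_cst x) a = a.
Proof.
rewrite -[a]class_reprK class_catE; apply/to_homotopy_classP.
exact: path_cat1p.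
Qed.

Lemma class_cata1 (x y : X) (a : homotopy_class x y) :
  class_cat a (class_cst y) = a.
Proof.
rewrite -[a]class_reprK class_catE; apply/to_homotopy_classP.
exact: path_catp1.
Qed.

Lemma class_catA (x y z w : X) (a : homotopy_class x y)
    (b : homotopy_class y z) (c : homotopy_class z w) :
  class_cat a (class_cat b c) = class_cat (class_cat a b) c.
Proof.
rewrite -[a]class_reprK -[b]class_reprK -[c]class_reprK !class_catE.
by apply/to_homotopy_classP/path_homotopic_sym; exact: path_catA.
Qed.

Lemma class_cataV (x y : X) (a : homotopy_class x y) :
  class_cat a (class_rev a) = class_cst x.
Proof.
rewrite -{1}[a]class_reprK class_catE; apply/to_homotopy_classP.
exact: path_catpV.
Qed.

Lemma class_catVa (x y : X) (a : homotopy_class x y) :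
  class_cat (class_rev a) a = class_cst y.
Proof.
rewrite -{2}[a]class_reprK class_catE; apply/to_homotopy_classP.
by have := path_catpV (path_rev (class_repr a)); rewrite path_revK.
Qed.

Definition fundamental_category : category :=
  @Category X homotopy_class class_cst (fun x y z f g => class_cat g f)
    (fun x y z w f g h => esym (class_catA h g f))
    (fun x y f => class_cata1 f)
    (fun x y f => class_cat1a f).

Definition fundamental_groupoid : groupoid :=
  @Groupoid fundamental_category class_rev
    (fun x y f => class_cataV f)
    (fun x y f => class_catVa f).

(* The product of two classes of loops follows the first factor first, as is
   usual for the fundamental group; hence it is opposite to composition of
   endomorphisms in the fundamental groupoid. *)
Definition fundamental_group (x : X) : Type := homotopy_class x x.

HB.instance Definition _ (x : X) := Choice.on (fundamental_group x).
HB.instance Definition _ (x : X) := isGroup.Build (fundamental_group x)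
  (@class_catA x x x x) (@class_cat1a x x) (@class_cata1 x x)
  (@class_catVa x x) (@class_cataV x x).

End Paths.

Arguments path_connected R X : clear implicits.
Arguments fundamental_groupoid R X : clear implicits.
Arguments fundamental_group R {X} x.

(* Main.v *)
Require Import Defs.
From mathcomp Require Import all_boot all_order all_algebra.
From mathcomp Require Import all_classical all_reals all_analysis.
Import Defs.

(** In a groupoid whose objects are all reachable from a base object [b],
    choose an arrow [c x] from [b] to every object [x]. The map sending
    [f : hom x y] to the endomorphism [(c y)^-1 o f o c x] of [b]
    ([at_base c f]) preserves identities and composition: it is a functor from
    the groupoid to the group [hom b b]. Calling two morphisms equivalent when
    their images agree gives a concentration structure. Identities are equivalent
    and composition respects classes because [at_base c] is a functor; classes
    multiply associatively because [hom b b] is associative; and any two classes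
    have composable representatives, since each morphism is equivalent to an
    endomorphism of any prescribed object [x], obtained by conjugating its image
    by [c x] ([at_obj]).

    Since [at_base] restricts to a bijection from [hom x x] to [hom b b], each
    class contains exactly one endomorphism of [x], and the concentration group
    is [hom x x], at every [x] and for one and the same relation. On the
    fundamental groupoid, composition in [hom x x] is opposite to the product
    of the fundamental group, and inversion identifies a group with its
    opposite; so the isomorphism sends a loop to the class of its inverse.
    Path-connectedness provides both the base point and the arrows [c x]. *)

Set Implicit Arguments.
Unset Strict Implicit.
Unset Printing Implicit Defensive.

Lemma invmK (G : groupoid) (x y : G) (f : hom x y) : invm (invm f) = f.
Proof.
by rewrite -[LHS]compmI -(compVm f) compmA compVm compIm.
Qed.

Lemma invm_comp (G : groupoid) (x y z : G) (f : hom y z) (g : hom x y) :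
  invm (compm f g) = compm (invm g) (invm f).
Proof.
rewrite -[RHS]compmI -(compmV (compm f g)) compmA; set k := invm (compm f g).
rewrite (compmA _ f g) -(compmA (invm g) (invm f) f) compVm compmI compVm.
by rewrite compIm.
Qed.

Section Frame.
Context {G : groupoid} {b : G} (c : forall x : G, hom b x).

Definition at_base (x y : G) (f : hom x y) : hom b b :=
  compm (invm (c y)) (compm f (c x)).

Definition at_obj (x : G) (u : hom b b) : hom x x :=
  compm (c x) (compm u (invm (c x))).

Lemma at_base_id (x : G) : at_base (idm x) = idm b.
Proof. by rewrite /at_base compIm compVm. Qed.

Lemma at_base_comp (x y z : G) (f : hom y z) (g : hom x y) :
  at_base (compm f g) = compm (at_base f) (at_base g).
Proof.
rewrite /at_base -!compmA; congr (compm _ (compm f _)).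
by rewrite compmA compmV compIm.
Qed.

Lemma at_objK (x : G) : cancel (@at_obj x) (@at_base x x).
Proof.
move=> u; rewrite /at_base /at_obj -!compmA compVm compmI.
by rewrite compmA compVm compIm.
Qed.

Lemma at_baseK (x : G) : cancel (@at_base x x) (@at_obj x).
Proof.
move=> f; rewrite /at_base /at_obj -!compmA compmV compmI.
by rewrite compmA compmV compIm.
Qed.

Definition same_at_base (f g : mor G) : Prop :=
  at_base (arrow f) = at_base (arrow g).

Lemma same_at_base_comp (A B D A' B' D' : G)
    (f : hom B D) (g : hom A B) (f' : hom B' D') (g' : hom A' B') :
  same_at_base (Mor f) (Mor f') -> same_at_base (Mor g) (Mor g') ->
  same_at_base (Mor (compm f g)) (Mor (compm f' g')).
Proof. by rewrite /same_at_base /= !at_base_comp => -> ->. Qed.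

Lemma same_at_base_composable (f g : mor G) :
  exists (A B D : G) (f' : hom B D) (g' : hom A B),
    same_at_base (Mor f') f /\ same_at_base (Mor g') g.
Proof.
exists b, b, b, (at_obj b (at_base (arrow f))), (at_obj b (at_base (arrow g))).
by rewrite /same_at_base /= !at_objK.
Qed.

Lemma same_at_base_assoc (A1 B1 D1 A2 B2 D2 A3 B3 D3 A4 B4 D4 : G)
    (f : hom B1 D1) (g : hom A1 B1) (g' : hom B2 D2) (h' : hom A2 B2)
    (f' : hom B3 D3) (n : hom A3 B3) (m : hom B4 D4) (h : hom A4 B4) :
  same_at_base (Mor f) (Mor f') -> same_at_base (Mor g) (Mor g') ->
  same_at_base (Mor h) (Mor h') -> same_at_base (Mor m) (Mor (compm f g)) ->
  same_at_base (Mor n) (Mor (compm g' h')) ->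
  same_at_base (Mor (compm f' n)) (Mor (compm m h)).
Proof.
rewrite /same_at_base /= !at_base_comp => <- eg -> -> ->.
by rewrite eg compmA.
Qed.

Definition frame_concentration : concentration G :=
  @Concentration G same_at_base (fun=> erefl) (fun f g => @esym _ _ _)
    (fun g f h => @etrans _ _ _ _)
    (fun A B => etrans (at_base_id A) (esym (at_base_id B)))
    same_at_base_comp same_at_base_composable same_at_base_assoc.

Definition endo_class (x : G) (u : hom x x) : conc_class frame_concentration :=
  to_class frame_concentration (Mor u).

Lemma endo_class_inj (x : G) : injective (@endo_class x).
Proof. by move=> u v /to_classP; exact: (can_inj (@at_baseK x)). Qed.

Lemma endo_class_surj (x : G) (a : conc_class frame_concentration) :
  exists u : hom x x, endo_class u = a.
Proof.
have [f ->] := to_class_surj a; exists (at_obj x (at_base (arrow f))).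
by apply/to_classP; exact: at_objK.
Qed.

(** The map [e] reverses products, as the identity map does when [M] is a
    fundamental group, whose product concatenates loops from left to right.
    Inverting endomorphisms reverses them once more, so that
    [u |-> endo_class (invm (e u))] is a homomorphism; it meets each class
    exactly once. *)
Lemma frame_concentration_iso (x : G) (M : monoidType) (e : M -> hom x x) :
  bijective e -> e 1%g = idm x ->
  (forall u v, e (u * v)%g = compm (e v) (e u)) ->
  monoid_isomorphic (conc_group frame_concentration x) M.
Proof.
move=> [e' eK e'K] e1 eM.
pose psi u : conc_group frame_concentration x := endo_class (invm (e u)).
have psi_inj : injective psi.
  move=> u v /endo_class_inj /(congr1 (@invm _ _ _)); rewrite !invmK.
  exact: (can_inj eK).
have psi1 : psi 1%g = 1%g.
  by rewrite /psi e1 -[invm _]compmI compVm.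
have psiM u v : psi (u * v)%g = (psi u * psi v)%g.
  by rewrite /psi eM invm_comp; apply/esym; exact: conc_mulE.
have /choice[phi phiK] : forall a, exists u, psi u = a.
  move=> a; have [f <-] := endo_class_surj x a.
  by exists (e' (invm f)); rewrite /psi e'K invmK.
exists phi; split.
- by exists psi => // u; exact: psi_inj.
- by apply: psi_inj; rewrite phiK psi1.
- by move=> u v; apply: psi_inj; rewrite psiM !phiK.
Qed.

End Frame.

Theorem theorem1p14 (R : realType) (X : topologicalType)
    (hX : path_connected R X) :
  (exists s : concentration (fundamental_groupoid R X),
     forall x0 : X,
       monoid_isomorphic (conc_group s x0) (fundamental_group R x0)) /\
  (forall x0 : X,
     horizontal_categorification (fundamental_groupoid R X)
       (fundamental_group R x0)).
Proof.
have [s iso_s] : exists s : concentration (fundamental_groupoid R X),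
    forall x0 : X,
      monoid_isomorphic (conc_group s x0) (fundamental_group R x0).
  have [[b] paths] := hX.
  pose c (x : fundamental_groupoid R X) :
      @hom (fundamental_groupoid R X) b x :=
    to_homotopy_class (inhabited_witness (paths b x)).
  exists (frame_concentration c) => x0.
  apply: (@frame_concentration_iso _ _ c x0 (fundamental_group R x0) id) => //.
  by exists id.
by split=> [|x0]; [exists s|exists s, x0; exact: iso_s].
Qed.
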